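(* Let $R$ be a commutative ring with identity, let $M_1, M_2, N$ be $R$-modules, and let $f_i : M_i \to N$ ($i=1,2$) be $R$-linear maps. If the $R$-modules $M_1$, $M_2$ and $N$ are hereditary (in particular, if $R$ is itself a hereditary ring), then one has the factorization $$\ker(f_1,f_2)\cong\ker(f_1)\oplus\ker(f_1\mid f_2)$$ and, consequently, $$\ker(f_1\mid f_2)\cong\ker(f_1,f_2)/\ker(f_1).$$
   Context: For $R$-linear maps $f_1:M_1\to N$ and $f_2:M_2\to N$, define $\ker(f_1\mid f_2)=\{m_2\in M_2 \mid \exists m_1\in M_1 : f_1(m_1)+f_2(m_2)=0\}$, an $R$-submodule of $M_2$, and $\ker(f_1,f_2)=\{(m_1,m_2)\in M_1\oplus M_2 \mid f_1(m_1)+f_2(m_2)=0\}$. The module $\ker(f_1)$ is regarded as a submodule of $\ker(f_1,f_2)$ via $m_1\mapsto(m_1,0)$. An $R$-module $M$ is called hereditary if every submodule of $M$ is projective. A commutative ring $R$ is called hereditary if every ideal of $R$ is projective; in that case every projective $R$-module is hereditary.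
   Formalization: In the parenthetical case where R is a hereditary ring, the modules M1, M2 and N are additionally assumed projective; for arbitrary modules the factorization fails (R = Z, M1 = Z → N = Z/2 the projection, M2 = Z/2, f2 = id). *)

(* Defs.v *)
From HB Require Import structures.
From mathcomp Require Import all_boot all_algebra.
From mathcomp Require Import boolp.

Set Implicit Arguments.
Unset Strict Implicit.
Unset Printing Implicit Defensive.

Import GRing.Theory.
Local Open Scope ring_scope.
Local Open Scope quotient_scope.

(* Submodules are boolean predicates with a [submodClosed] structure; [asbool]
   (notation [`[< P >]]) turns any Prop-valued predicate into a boolean one, so
   this covers every submodule. *)
Section Submodule.
Variables (R : pzRingType) (V : lmodType R) (S : submodClosed V).

Definition submod : Type := {x : V | x \in S}.

HB.instance Definition _ := SubChoice.on submod.
HB.instance Definition _ := [SubChoice_isSubLmodule of submod by <:].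

(* [Quotient.quot] expects a [zmodClosed] predicate; over a ring, closure under
   opposites follows from closure under scaling. *)
Definition submod_pred : {pred V} := S.

Fact submod_pred_zmod_closed : zmod_closed submod_pred.
Proof. exact: GRing.submod_closedB (submodClosedP S). Qed.

HB.instance Definition _ :=
  GRing.isZmodClosed.Build V submod_pred submod_pred_zmod_closed.

Definition quotmod : Type := Quotient.quot submod_pred.

HB.instance Definition _ := Choice.on quotmod.
HB.instance Definition _ := GRing.Zmodule.on quotmod.
HB.instance Definition _ :
  ZmodQuotient V (Quotient.equiv submod_pred) 0 -%R +%R quotmod :=
  ZmodQuotient.on quotmod.

Definition quotmod_scale (a : R) := lift_op1 quotmod ( *:%R a).

Fact pi_quotmod_scale a x :
  quotmod_scale a (\pi_quotmod x) = \pi_quotmod (a *: x).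
Proof.
unlock quotmod_scale; apply/eqP; rewrite -(Quotient.idealrBE submod_pred) -scalerBr.
apply: (rpredZ (s := S)); rewrite -[_ \in _]/(_ \in submod_pred).
by rewrite Quotient.idealrBE reprK.
Qed.

Fact quotmod_scaleA a b q :
  quotmod_scale a (quotmod_scale b q) = quotmod_scale (a * b) q.
Proof. by rewrite -[q]reprK !pi_quotmod_scale scalerA. Qed.

Fact quotmod_scale1 : left_id 1 quotmod_scale.
Proof. by move=> q; rewrite -[q]reprK pi_quotmod_scale scale1r. Qed.

Fact quotmod_scaleDr : right_distributive quotmod_scale +%R.
Proof.
move=> a p q; rewrite -[p]reprK -[q]reprK -raddfD !pi_quotmod_scale.
by rewrite scalerDr raddfD.
Qed.

Fact quotmod_scaleDl q : {morph quotmod_scale^~ q : a b / a + b}.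
Proof.
by move=> a b; rewrite -[q]reprK !pi_quotmod_scale scalerDl raddfD.
Qed.

HB.instance Definition _ := GRing.Zmodule_isLmodule.Build R quotmod
  quotmod_scaleA quotmod_scale1 quotmod_scaleDr quotmod_scaleDl.

End Submodule.

Definition lmod_iso (R : pzRingType) (U V : lmodType R) : Prop :=
  exists f : {linear U -> V}, bijective f.

Definition projective (R : pzRingType) (P : lmodType R) : Prop :=
  forall (A B : lmodType R) (g : {linear A -> B}) (h : {linear P -> B}),
    (forall b, exists a, g a = b) ->
    exists k : {linear P -> A}, forall x, g (k x) = h x.

Definition hereditary (R : pzRingType) (M : lmodType R) : Prop :=
  forall S : submodClosed M, projective (submod S).

(* The ideals of a commutative ring R are the submodules of the regular module
   R^o. The library's [idealr] is not suitable, being restricted to proper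
   ideals. *)
Definition hereditary_ring (R : comPzRingType) : Prop :=
  forall I : submodClosed R^o, projective (submod I).

Section Image.
Variables (R : pzRingType) (U V : lmodType R) (f : {linear U -> V}).

Definition lin_im : {pred V} := [pred y | `[< exists x, f x = y >]].

Fact lin_im_submod_closed : submod_closed lin_im.
Proof.
split=> [|a _ _ /asboolP[x <-] /asboolP[y <-]]; apply/asboolP.
  by exists 0; rewrite linear0.
by exists (a *: x + y); rewrite linearP.
Qed.

HB.instance Definition _ :=
  GRing.isSubmodClosed.Build R V lin_im lin_im_submod_closed.

End Image.

Section Kernel.
Variables (R : pzRingType) (M N : lmodType R) (f : {linear M -> N}).

Definition lin_ker : {pred M} := [pred m | f m == 0].

Fact lin_ker_submod_closed : submod_closed lin_ker.
Proof.
split=> [|a x y]; rewrite !inE ?linear0 // => /eqP fx /eqP fy.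
by rewrite linearP fx fy scaler0 addr0.
Qed.

HB.instance Definition _ :=
  GRing.isSubmodClosed.Build R M lin_ker lin_ker_submod_closed.

End Kernel.

Section KernelPair.
Variables (R : pzRingType) (M1 M2 N : lmodType R).
Variables (f1 : {linear M1 -> N}) (f2 : {linear M2 -> N}).

(* ker(f1, f2), as a submodule of M1 (+) M2 *)
Definition ker_pair : {pred M1 * M2} := [pred m | f1 m.1 + f2 m.2 == 0].

Fact ker_pair_submod_closed : submod_closed ker_pair.
Proof.
split=> [|a x y]; rewrite !inE /= ?linear0 ?addr0 // => /eqP fx /eqP fy.
by rewrite !linearP addrACA -scalerDr fx fy scaler0 addr0.
Qed.

HB.instance Definition _ :=
  GRing.isSubmodClosed.Build R (M1 * M2)%type ker_pair ker_pair_submod_closed.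

(* ker(f1 | f2), as a submodule of M2 *)
Definition ker_rel : {pred M2} :=
  [pred m2 | `[< exists m1, f1 m1 + f2 m2 = 0 >]].

Fact ker_rel_submod_closed : submod_closed ker_rel.
Proof.
split=> [|a x y /asboolP[x1 ex] /asboolP[y1 ey]]; apply/asboolP.
  by exists 0; rewrite !linear0 addr0.
by exists (a *: x1 + y1); rewrite !linearP addrACA -scalerDr ex ey scaler0 addr0.
Qed.

HB.instance Definition _ :=
  GRing.isSubmodClosed.Build R M2 ker_rel ker_rel_submod_closed.

Fact ker_incl_subproof (m : submod (lin_ker f1)) :
  (val m, 0 : M2) \in ker_pair.
Proof. by rewrite inE /= linear0 addr0; exact: valP m. Qed.

(* m1 |-> (m1, 0) *)
Definition ker_incl (m : submod (lin_ker f1)) : submod ker_pair :=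
  Sub (val m, 0) (ker_incl_subproof m).

Fact ker_incl_is_linear : linear ker_incl.
Proof.
move=> a x y; apply: val_inj; rewrite linearP /=.
by congr pair; rewrite ?linearP //= scaler0 addr0.
Qed.

HB.instance Definition _ :=
  GRing.isLinear.Build R (submod (lin_ker f1)) (submod ker_pair) *:%R
    ker_incl ker_incl_is_linear.

End KernelPair.

Arguments ker_incl {R M1 M2 N} f1 f2 m.

(* Main.v *)
Require Import Defs.
From HB Require Import structures.
From mathcomp Require Import all_boot all_algebra.
From mathcomp Require Import boolp.
From mathcomp Require Import finmap classical_sets functions fsbigop.
Local Open Scope ring_scope.

Set Implicit Arguments.
Unset Strict Implicit.
Unset Printing Implicit Defensive.
Import GRing.Theory.

(** The second projection maps ker(f1, f2) onto ker(f1 | f2), and its kernel is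
    the copy of ker(f1) given by [ker_incl].  Both isomorphisms therefore follow
    as soon as this surjection has a linear section
    ([split_exact_prod], [split_exact_quot]), and it has one when its target,
    a submodule of M2, is projective.

    If M2 is hereditary, that is the definition.  If R is a hereditary ring and
    M2 is projective, one needs the theorem of Kaplansky that submodules of
    projective R-modules are projective ([projective_hereditary]).  A projective
    module embeds in a free one, so each of its submodules X carries linear
    coordinates c_i : X -> R that separate points and of which only finitely
    many are nonzero at any given element.  Such an X is projective
    ([coordinates_projective]).  To lift a map X -> B through a surjection
    A -> B, apply Zorn's lemma to lifts defined on the submodules X_J of
    elements whose coordinates vanish outside J.  Chains are bounded because
    supports are finite ([chain_upper_bound]).  If i is not in J, then c_i maps
    the submodule of J + {i} onto an ideal of R, which is projective, with
    kernel X_J.  The submodule of J + {i} is thus the direct sum of X_J and a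
    projective module, and a lift on X_J extends to it ([lifts_on_extend]).
    Any i outside J will do, because only the lifting property is built;
    Kaplansky's decomposition of X into ideals follows a well-ordering of I. *)

(** * Linear maps and isomorphisms *)

(** Linear structures on locally defined functions; stated up to pointwise
    equality so that the function itself stays folded in later goals. *)
Lemma linear_bundle (R : pzRingType) (U V : lmodType R) (f : U -> V) :
  linear f -> exists g : {linear U -> V}, g =1 f.
Proof.
move=> lf; pose fL := GRing.isLinear.Build R U V *:%R f lf.
by exists (HB.pack_for {linear U -> V} f fL).
Qed.

Lemma linear_bijective (R : pzRingType) (U V : lmodType R)
    (f : {linear U -> V}) :
  (forall x, f x = 0 -> x = 0) -> (forall y, exists x, f x = y) -> bijective f.
Proof.
move=> f0 /choice[g gK]; exists g => // x.
by apply/eqP; rewrite -subr_eq0; apply/eqP/f0; rewrite linearB /= gK subrr.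
Qed.

Lemma lmod_iso_sym (R : pzRingType) (U V : lmodType R) :
  lmod_iso U V -> lmod_iso V U.
Proof.
move=> [f [g fK gK]].
have [a x y|g' g'E] := @linear_bundle R V U g.
  by apply: (can_inj fK); rewrite linearP !gK.
by exists g'; exists f => x; rewrite g'E.
Qed.

Section Quotient.
Variables (R : pzRingType) (V : lmodType R) (S : submodClosed V).

Lemma pi_quotmod_linear : linear (\pi_(quotmod S))%qT.
Proof.
move=> a x y; rewrite raddfD; congr (_ + _); exact/esym/pi_quotmod_scale.
Qed.

Lemma pi_quotmod_eq0 x : (\pi_(quotmod S) x)%qT = 0 <-> x \in S.
Proof.
rewrite -(raddf0 (\pi_(quotmod S))%qT) -[in X in _ <-> X](subr0 x).
have := Quotient.idealrBE (submod_pred S) x 0.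
rewrite -[_ \in submod_pred S]/(_ \in S) => ->.
by split=> /eqP.
Qed.

End Quotient.

(** Lift the identity of P. *)
Lemma projective_section (R : pzRingType) (E P : lmodType R)
    (p : {linear E -> P}) :
  projective P -> (forall y, exists x, p x = y) ->
  exists s : {linear P -> E}, cancel s p.
Proof. by move=> Pproj /(Pproj E P p idfun). Qed.

Section SplitExact.
Variables (R : pzRingType) (K E Q : lmodType R).
Variables (i : {linear K -> E}) (p : {linear E -> Q}) (s : {linear Q -> E}).
Hypothesis i_inj : injective i.
Hypothesis exact_ip : forall e, p e = 0 <-> exists k, i k = e.
Hypothesis sK : cancel s p.

Lemma split_exact_prod : lmod_iso E (K * Q)%type.
Proof.
apply: lmod_iso_sym.
have pi0 k : p (i k) = 0 by apply/exact_ip; exists k.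
have [a [k q] [k' q'] /=|f fE] :=
    @linear_bundle R (K * Q)%type E (fun kq => i kq.1 + s kq.2).
  by rewrite !linearP /= scalerDr addrACA.
exists f; apply: linear_bijective => [[k q]|e]; last first.
  have /exact_ip[k ik] : p (e - s (p e)) = 0 by rewrite linearB /= sK subrr.
  by exists (k, p e); rewrite fE /= ik subrK.
rewrite fE /= => ks0.
have q0 : q = 0 by rewrite -(sK q) -[LHS]add0r -(pi0 k) -linearD /= ks0 linear0.
move: ks0; rewrite q0 linear0 addr0 => ik0.
by congr pair; apply: i_inj; rewrite ik0 linear0.
Qed.

Lemma split_exact_quot : lmod_iso Q (quotmod (lin_im i)).
Proof.
have [a x y|f fE] :=
    @linear_bundle R Q (quotmod (lin_im i)) (fun q => \pi_(quotmod _) (s q))%qT.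
  by rewrite linearP /= pi_quotmod_linear.
exists f; apply: linear_bijective => [q|c].
  by rewrite fE => /pi_quotmod_eq0/asboolP/exact_ip; rewrite sK.
exists (p (repr c)); rewrite fE; apply/eqP; rewrite -[X in _ == X]reprK.
rewrite -subr_eq0 -raddfB; apply/eqP/pi_quotmod_eq0/asboolP/exact_ip.
by rewrite linearB /= sK subrr.
Qed.

End SplitExact.

(** * Submodules of free modules over a hereditary ring *)

Section Coordinates.
Variables (R : pzRingType) (X : lmodType R) (I : eqType).
Variable c : I -> {linear X -> R^o}.

(** The family c embeds X in the free module on I. *)
Definition coordinates : Prop :=
  (forall x, exists s : seq I, forall i, c i x != 0 -> i \in s) /\
  (forall x, (forall i, c i x = 0) -> x = 0).

Definition supported (J : set I) : {pred X} :=
  [pred x | `[< forall i, ~ J i -> c i x = 0 >]].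

Fact supported_submod_closed J : submod_closed (supported J).
Proof.
split=> [|a x y /asboolP xJ /asboolP yJ]; apply/asboolP => i iJ.
  by rewrite linear0.
by rewrite linearP xJ // yJ // scaler0 addr0.
Qed.

HB.instance Definition _ J :=
  GRing.isSubmodClosed.Build R X (supported J) (supported_submod_closed J).

Lemma supportedS (J J' : set I) x :
  (forall i, J i -> J' i) -> x \in supported J -> x \in supported J'.
Proof.
move=> JJ' /asboolP xJ; apply/asboolP => i iJ'; apply: xJ => iJ.
exact/iJ'/JJ'.
Qed.

End Coordinates.

Section HereditaryCoordinates.
Variables (R : comPzRingType) (X : lmodType R) (I : eqType).
Variable c : I -> {linear X -> R^o}.
Hypothesis Rher : hereditary_ring R.
Hypothesis cX : coordinates c.
Variables (A B : lmodType R) (g : {linear A -> B}) (h : {linear X -> B}).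
Hypothesis g_surj : forall b, exists a, g a = b.

(** A partial lift is encoded by a total function constrained on X_J alone: a
    chain of partial lifts can then be glued by choice, with no transport
    between the types of different submodules. *)
Definition lifts_on (J : set I) (k : X -> A) : Prop :=
  (forall a x y, x \in supported c J -> y \in supported c J ->
     k (a *: x + y) = a *: k x + k y) /\
  (forall x, x \in supported c J -> g (k x) = h x).

Definition partial_lift := {Jk : set I * (X -> A) | lifts_on Jk.1 Jk.2}.

(** Only a preorder, since two partial lifts may differ outside their common
    domain; Zorn's lemma for preorders is enough. *)
Definition extends (t t' : partial_lift) : bool :=
  `[< (forall i, (sval t).1 i -> (sval t').1 i) /\
      {in supported c (sval t).1, (sval t).2 =1 (sval t').2} >].

(** The coordinates separate points, so the submodule over the empty set is
    zero and the search for a maximal lift can start. *)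
Lemma lifts_on0 : lifts_on set0 (fun=> 0).
Proof.
split=> [a x y _ _|x /asboolP x0]; first by rewrite scaler0 addr0.
suff -> : x = 0 by rewrite !linear0.
by apply: cX.2 => i; exact: x0.
Qed.

(** Take the union J of the index sets.  An element supported on J has finite
    support, so it is already supported on the index set of one member of the
    chain, and any two members that are defined there agree. *)
Lemma chain_upper_bound (C : set partial_lift) :
  total_on C extends -> exists t, forall s, C s -> extends s t.
Proof.
move=> totC; have [[t0 Ct0]|C0] := pselect (exists t, C t); last first.
  by exists (exist _ (set0, fun=> 0) lifts_on0) => s Cs; case: C0; exists s.
pose J i := exists2 t, C t & (sval t).1 i.
(* Directedness is the only consequence of totality that the gluing uses. *)
have dir t t' : C t -> C t' -> exists u, [/\ C u, extends t u & extends t' u].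
  have refl u : extends u u by apply/asboolP.
  by move=> Ct Ct'; have [] := totC _ _ Ct Ct'; [exists t'|exists t].
have sup_ext t u x : extends t u -> x \in supported c (sval t).1 ->
    x \in supported c (sval u).1.
  by move=> /asboolP[tu _]; exact: supportedS.
have finJ x : x \in supported c J ->
    exists t, C t /\ x \in supported c (sval t).1.
  move=> /asboolP xJ; have [s sP] := cX.1 x.
  have : exists2 t, C t & forall i, i \in s -> J i -> (sval t).1 i.
    elim: s {sP} => [|i s [t Ct IH]]; first by exists t0.
    have [[t' Ct' t'i]|nJi] := pselect (J i); last first.
      by exists t => // j; rewrite inE => /orP[/eqP->|/IH].
    have [u [Cu /asboolP[tu _] /asboolP[t'u _]]] := dir _ _ Ct Ct'.
    exists u => // j; rewrite inE => /orP[/eqP-> _|js Jj]; first exact: t'u.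
    exact/tu/IH.
  move=> [t Ct tP]; exists t; split=> //; apply/asboolP => i nti.
  apply/eqP; apply: contraPT (nti) => cix nti'.
  have Ji : J i by apply: contrapT => /xJ/eqP; rewrite (negbTE cix).
  exact: nti' (tP i (sP _ cix) Ji).
have kP x : exists a, forall t, C t -> x \in supported c (sval t).1 ->
    (sval t).2 x = a.
  have [[t [Ct xt]]|no] :=
    pselect (exists t, C t /\ x \in supported c (sval t).1); last first.
    by exists 0 => t Ct xt; case: no; exists t.
  exists ((sval t).2 x) => t' Ct' xt'.
  have [u [Cu /asboolP[_ tu] /asboolP[_ t'u]]] := dir _ _ Ct Ct'.
  by rewrite tu // t'u.
have [k kE] := choice kP.
have kL : lifts_on J k.
  split=> [a x y /finJ[t [Ct xt]] /finJ[t' [Ct' yt']]|x /finJ[t [Ct xt]]].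
    have [u [Cu tu t'u]] := dir _ _ Ct Ct'.
    have xu := sup_ext _ _ _ tu xt; have yu := sup_ext _ _ _ t'u yt'.
    have zu : a *: x + y \in supported c (sval u).1 by rewrite rpredD ?rpredZ.
    by rewrite -!(kE _ u) // (svalP u).1.
  by rewrite -(kE _ t) // (svalP t).2.
exists (exist _ (J, k) kL) => t Ct; apply/asboolP; split=> /= [i ti|x xt].
  by exists t.
exact: kE.
Qed.

(** Let X' be the submodule over J + {i} and Q the ideal c_i(X').  As Q is
    projective, p : X' -> Q induced by c_i has a section s, and the map from Q
    to B given by h o s has a lift l.  Then r(x) = x - s(p x) lies in the
    submodule over J, and k(r x) + l(p x) is the required extension. *)
Lemma lifts_on_extend (J : set I) (k : X -> A) (i : I) :
  ~ J i -> lifts_on J k ->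
  exists2 k', lifts_on (fun j => J j \/ j = i) k' &
    {in supported c J, k =1 k'}.
Proof.
move=> nJi [k_lin kg]; pose J' : set I := fun j => J j \/ j = i.
pose X' := submod (supported c J').
have [a x y|ci ciE] := @linear_bundle R X' R^o (fun x => c i (val x)).
  by rewrite !linearP.
pose Q := submod (lin_im ci).
have ci_im (x : X') : ci x \in lin_im ci by apply/asboolP; exists x.
pose p0 x : Q := Sub (ci x) (ci_im x).
have [a x y|p pE] := @linear_bundle R X' Q p0.
  by apply: val_inj; rewrite /= !linearP.
have Qproj : projective Q by exact: Rher.
have p_surj (q : Q) : exists x, p x = q.
  have /asboolP[x xq] := valP q; exists x.
  by apply: val_inj; rewrite pE /= xq.
have [s sK] := projective_section Qproj p_surj.
have [a x y|hs hsE] := @linear_bundle R Q B (fun q => h (val (s q))).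
  by rewrite !linearP.
have [l lE] := Qproj A B g hs g_surj.
have [a x y|r rE] := @linear_bundle R X' X (fun x => val (x - s (p x))).
  rewrite -linearP; congr val.
  by rewrite !linearP /= addrACA -scalerDr.
have rJ x : r x \in supported c J.
  apply/asboolP => j nJj; rewrite rE.
  have [->|ji] := eqVneq j i.
    by rewrite -ciE -[ci _]/(val (p0 _)) -pE linearB /= sK subrr.
  have /asboolP := valP (x - s (p x)); apply => -[//|/eqP].
  by rewrite (negbTE ji).
pose k' x := let x' := insubd (0 : X') x in k (r x') + l (p x').
have k'E (x : X') : k' (val x) = k (r x) + l (p x) by rewrite /k' valKd.
exists k'; first split=> [a x y xJ yJ|x xJ].
- rewrite -[x]/(val (Sub x xJ : X')) -[y]/(val (Sub y yJ : X')).
  rewrite -linearP !k'E /= linearP k_lin // linearP /= linearP /=.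
  by rewrite scalerDr addrACA.
- rewrite -[x]/(val (Sub x xJ : X')) k'E linearD /= kg // lE hsE -linearD.
  by rewrite rE linearB /= subrK.
move=> x xJ.
have xJ' : x \in supported c J' by apply: supportedS xJ => j; left.
rewrite -[x in RHS]/(val (Sub x xJ' : X')) k'E.
(* Here c_i vanishes because i is not in J; hence r x = x and l (p x) = 0. *)
have px0 : p (Sub x xJ') = 0.
  by apply: val_inj; rewrite pE /= ciE /=; exact: (asboolP _ xJ).
by rewrite rE px0 !linear0 !addr0.
Qed.

End HereditaryCoordinates.

Lemma coordinates_projective (R : comPzRingType) (X : lmodType R) (I : eqType)
    (c : I -> {linear X -> R^o}) :
  hereditary_ring R -> coordinates c -> projective X.
Proof.
move=> Rher cX A B g h g_surj.
have [|r s t /asboolP[rs rsE] /asboolP[st stE]|C|] :=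
    @ZL_preorder (partial_lift c g h)
      (exist _ (set0, fun=> 0) (lifts_on0 cX g h))
      (@extends _ _ _ c _ _ g h).
- by move=> t; apply/asboolP.
- apply/asboolP; split=> [i ri|x xr]; first exact/st/rs.
  by rewrite rsE // stE //; exact: supportedS xr.
- exact: chain_upper_bound.
move=> [[J k] /= kL] tmax.
(* Otherwise the extension to J + {i} contradicts maximality. *)
have Jfull i : J i.
  apply: contrapT => nJi.
  have [k' k'L kk'] := lifts_on_extend Rher g_surj nJi kL.
  have /tmax/asboolP[/= J'J _] : extends (exist _ (J, k) kL)
      (exist _ (fun j => J j \/ j = i, k') k'L).
    by apply/asboolP; split=> //= j; left.
  by apply: nJi; apply: J'J; right.
have XJ x : x \in supported c J by apply/asboolP => i /(_ (Jfull i)).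
have [|k' k'E] := @linear_bundle R X A k; first by move=> a x y; rewrite kL.1.
by exists k' => x; rewrite k'E kL.2.
Qed.

(** * Coordinates on projective modules *)

Section FreeModule.
Variables (R : pzRingType) (P : lmodType R).

Definition finitely_supported : {pred P -> R^o} :=
  [pred f | `[< exists D : {fset P}, forall x, x \notin D -> f x = 0 >]].

Fact finitely_supported_submod_closed : submod_closed finitely_supported.
Proof.
split=> [|a f g /asboolP[D fD] /asboolP[E gE]]; apply/asboolP.
  by exists fset0.
exists (D `|` E)%fset => x; rewrite in_fsetU negb_or => /andP[xD xE].
by rewrite -[LHS]/(a *: f x + g x) fD // gE // scaler0 addr0.
Qed.

HB.instance Definition _ :=
  GRing.isSubmodClosed.Build R (P -> R^o) finitely_supported
    finitely_supported_submod_closed.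

Local Notation free_on := (submod finitely_supported).

(** The canonical surjection from the free module on the set P onto the
    module P. *)
Definition combination (f : free_on) : P :=
  \sum_(x \in [set: P]) (val f x : R) *: x.

(** The sum may be taken over any finite set containing the support, which
    allows the sums of two functions to be compared term by term. *)
Lemma combinationE (f : free_on) (D : {fset P}) :
  (forall x, x \notin D -> val f x = 0) ->
  combination f = \sum_(x <- D) (val f x : R) *: x.
Proof. by move=> fD; apply: fsbigTE => x /fD ->; rewrite scale0r. Qed.

Lemma combination_linear : linear combination.
Proof.
move=> a f g; have /asboolP[D fD] := valP f; have /asboolP[E gE] := valP g.
have fDE x : x \notin (D `|` E)%fset -> val f x = 0.
  by rewrite in_fsetU negb_or => /andP[/fD].
have gDE x : x \notin (D `|` E)%fset -> val g x = 0.
  by rewrite in_fsetU negb_or => /andP[_ /gE].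
have fgE x : val (a *: f + g) x = a * val f x + val g x.
  by rewrite linearP.
rewrite (combinationE fDE) (combinationE gDE) (@combinationE _ (D `|` E)%fset).
  rewrite scaler_sumr -big_split; apply: eq_bigr => x _ /=.
  by rewrite scalerA -scalerDl; congr (_ *: _); exact: fgE.
by move=> x xDE; rewrite [LHS]fgE fDE // gDE // mulr0 addr0.
Qed.

Lemma combination_surj x : exists f, combination f = x.
Proof.
pose d y : R^o := if y == x then 1 else 0.
have d0 y : y \notin [fset x]%fset -> d y = 0.
  by rewrite in_fset1 /d => /negbTE ->.
have dP : d \in finitely_supported by apply/asboolP; exists [fset x]%fset.
exists (Sub d dP : free_on); rewrite (@combinationE _ [fset x]%fset) //=.
by rewrite big_seq_fset1 /d eqxx scale1r.
Qed.

End FreeModule.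

(** The dual basis lemma: a section of the surjection from the free module on P
    embeds P in it, and the coordinates are those of the free module. *)
Lemma projective_coordinates (R : pzRingType) (P : lmodType R) :
  projective P -> exists c : P -> {linear P -> R^o}, coordinates c.
Proof.
move=> Pproj; have [e eE] := linear_bundle (@combination_linear R P).
have [|s sK] :=
    @projective_section R (submod (@finitely_supported R P)) P e Pproj.
  by move=> x; have [f fx] := combination_surj x; exists f; rewrite eE.
have /choice[c cE] (i : P) : exists ci : {linear P -> R^o},
    forall x, ci x = val (s x) i.
  have [a x y|ci ciE] := @linear_bundle R P R^o (fun x => val (s x) i).
    by rewrite !linearP.
  by exists ci.
exists c; split=> [x|x cx0].
  have /asboolP[D sD] := valP (s x); exists D => i.
  by apply: contraNT => iD; rewrite cE sD.
rewrite -(sK x); suff -> : s x = 0 by rewrite linear0.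
by apply: val_inj; apply/funext => i; rewrite -cE cx0.
Qed.

(** The coordinates of P restrict to each submodule. *)
Lemma projective_hereditary (R : comPzRingType) (P : lmodType R) :
  hereditary_ring R -> projective P -> hereditary P.
Proof.
move=> Rher /projective_coordinates[c [c_fin c_sep]] S.
have /choice[cS cSE] (i : P) : exists ci : {linear submod S -> R^o},
    forall x, ci x = c i (val x).
  have [a x y|ci ciE] := @linear_bundle R (submod S) R^o (fun x => c i (val x)).
    by rewrite !linearP.
  by exists ci.
apply: (@coordinates_projective R (submod S) P cS Rher).
split=> [x|x cx0].
  by have [s sP] := c_fin (val x); exists s => i; rewrite cSE; exact: sP.
by apply: val_inj; apply: c_sep => i; rewrite -cSE cx0.
Qed.

(** * The factorization *)

Theorem theorem3p1 (R : comPzRingType) (M1 M2 N : lmodType R)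
    (f1 : {linear M1 -> N}) (f2 : {linear M2 -> N})
    (hH : (hereditary M1 /\ hereditary M2 /\ hereditary N) \/
          (hereditary_ring R /\ projective M1 /\ projective M2 /\ projective N)) :
  lmod_iso (submod (ker_pair f1 f2))
           (submod (lin_ker f1) * submod (ker_rel f1 f2))%type
  /\
  lmod_iso (submod (ker_rel f1 f2))
           (quotmod (lin_im (ker_incl f1 f2))).
Proof.
have M2her : hereditary M2.
  case: hH => [[_ [//]]|[Rher [_ [M2proj _]]]].
  exact: projective_hereditary.
have snd_ker (e : submod (ker_pair f1 f2)) : (val e).2 \in ker_rel f1 f2.
  by apply/asboolP; exists (val e).1; apply/eqP; exact: valP e.
have [a x y|p pE] := @linear_bundle R (submod (ker_pair f1 f2))
    (submod (ker_rel f1 f2)) (fun e => Sub (val e).2 (snd_ker e)).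
  by apply: val_inj; rewrite [RHS]linearP.
have p_surj q : exists e, p e = q.
  have /asboolP[m1 mq] := valP q.
  have eP : (m1, val q) \in ker_pair f1 f2 by rewrite inE /= mq.
  by exists (Sub (m1, val q) eP); rewrite pE; apply: val_inj.
have [s sK] := projective_section (M2her (ker_rel f1 f2)) p_surj.
have i_inj : injective (ker_incl f1 f2).
  by move=> x y /(congr1 val)[/val_inj].
have exact_ip e : p e = 0 <-> exists k, ker_incl f1 f2 k = e.
  rewrite pE; split=> [/(congr1 val) /= e20|[k <-]]; last exact: val_inj.
  have e1P : (val e).1 \in lin_ker f1.
    by have := valP e; rewrite !inE e20 linear0 addr0.
  exists (Sub (val e).1 e1P); apply: val_inj => /=.
  by rewrite -[in LHS]e20; case: (val e).
split; first exact: split_exact_prod i_inj exact_ip sK.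
exact: split_exact_quot exact_ip sK.
Qed.
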